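(* Let $k\in\mathbb{N}$ and for $i\in[k]$ let $G_i$ and $H_i$ be connected graphs with $\bigl||G_i|-|H_i|\bigr|\le2$. Then $$q\Bigl(\bigcup_{i=1}^kG_i\vee\bigcup_{i=1}^kH_i\Bigr)=2.$$ Moreover, if $m_1,\dots,m_k\in\mathbb{N}$ and $H_1,\dots,H_k$ are connected graphs with $m_i+2\ge|H_i|$ for all $i\in[k]$, then $$q\Bigl(\bigcup_{i=1}^kK_{m_i}\vee\bigcup_{i=1}^kH_i\Bigr)=2.$$
   Context: $S(G)$ is the set of real symmetric matrices indexed by $V(G)$ whose $(i,j)$ off-diagonal entry is nonzero iff $\{i,j\}\in E(G)$ (diagonal unrestricted); $q(G)=\min\{q(A):A\in S(G)\}$ with $q(A)$ the number of distinct eigenvalues of $A$. $\bigcup$ denotes disjoint union of graphs, $\vee$ the join (disjoint union plus all edges between the two vertex sets), $K_m$ the complete graph on $m$ vertices, and $|G|$ the number of vertices. *)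

(* Defs.v *)
From HB Require Import structures.
From mathcomp Require Import all_boot all_order all_algebra.
From mathcomp Require Import reals.
Set Implicit Arguments. Unset Strict Implicit. Unset Printing Implicit Defensive.
Import Order.TTheory GRing.Theory Num.Theory.
Local Open Scope ring_scope.

Definition simple_graph (T : finType) (e : rel T) : Prop :=
  symmetric e /\ irreflexive e.

Definition connected_graph (T : finType) (e : rel T) : Prop :=
  (0 < #|T|)%N /\ forall x y : T, connect e x y.

Definition gunion (I : finType) (T : I -> finType) (e : forall i, rel (T i))
  : rel {i : I & T i} :=
  fun u v => (tag u == tag v) && e (tag u) (tagged u) (tagged_as u v).

Definition gjoin (U W : finType) (eU : rel U) (eW : rel W) : rel (U + W)%type :=
  fun u v => match u, v with
             | inl x, inl y => eU x y
             | inr x, inr y => eW x y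
             | _, _ => true
             end.

Definition complete (m : nat) : rel 'I_m := fun x y => x != y.

Definition inS (R : realType) (T : finType) (e : rel T) (A : 'M[R]_#|T|) : Prop :=
  A^T = A /\
  forall x y : T, x != y -> (A (enum_rank x) (enum_rank y) != 0) = e x y.

Definition num_eig (R : realType) (n : nat) (A : 'M[R]_n) (m : nat) : Prop :=
  exists s : seq R, [/\ uniq s, size s = m & forall a, eigenvalue A a = (a \in s)].

Definition q_eq (R : realType) (T : finType) (e : rel T) (m : nat) : Prop :=
  (exists A, @inS R T e A /\ num_eig A m) /\
  (forall A n, @inS R T e A -> num_eig A n -> (m <= n)%N).

(* Main.v *)
Require Import Defs.
From HB Require Import structures.
From mathcomp Require Import all_boot all_order all_algebra.
From mathcomp Require Import boolp classical_sets reals.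
From mathcomp Require Import ring lra.
From mathcomp Require Import complex.
Set Implicit Arguments. Unset Strict Implicit. Unset Printing Implicit Defensive.
Import Order.TTheory GRing.Theory Num.Theory.
Local Open Scope ring_scope.

(* An orthogonal symmetric matrix [[A, B], [B^T, -C]] has the pattern of the
   join when [A] and [C] have the patterns of the two unions and [B] has no
   zero entry. It suffices that [A] and [C] share orthonormal eigenvectors
   [N], [M] for the eigenvalues [mu], all other eigenvalues being [1] or [-1];
   then [B = N sqrt(1 - mu^2) M^T].

   A connected graph realizes every simple spectrum with an orthonormal
   eigenbasis that is nowhere zero and as close to the identity as desired:
   perturb the diagonal matrix by edge weights [eps ^ a], correct the diagonal
   by a contraction argument, and choose the exponents [a] along a spanning
   tree so that each eigenvector entry has a single leading term. For one pair
   [G_i], [H_i], taking [M] much closer to the identity than [N] is to having a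
   zero makes the block of [B] nowhere zero. All pairs share the eigenvalue
   [0], and mixing its eigenvectors by a nowhere zero orthogonal [k x k] matrix
   near the identity fills the remaining blocks.

   For the lower bound, a symmetric matrix with one eigenvalue is scalar. *)

(** * Spanning trees with a unique descent *)

Definition unique_descent (T : finType) (S : {set T}) (t : rel T)
    (a D : T -> T -> nat) (next : T -> T -> T) : Prop :=
  (forall j, D j j = 0%N) /\
  forall i j, i \in S -> j \in S -> i != j ->
    [/\ t i (next i j), next i j \in S,
        D i j = (a i (next i j) + D (next i j) j)%N &
        forall k, k \in S -> t i k -> k != next i j -> (D i j < a i k + D k j)%N].

Lemma connect_exit (T : finType) (e : rel T) (S : {set T}) (x y : T) :
  connect e x y -> x \in S -> y \notin S ->
  exists q p, [/\ q \in S, p \notin S & e q p].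
Proof.
move=> /connectP[s]; elim: s x => [|z s IH] x /=.
  by move=> _ -> ->.
move=> /andP[exz pz] yl xS yS.
have [zS|zS] := boolP (z \in S); first exact: IH pz yl zS yS.
by exists x, z.
Qed.

Lemma spanning_tree_descent (T : finType) (e : rel T) :
  simple_graph e -> connected_graph e ->
  exists t D next,
    [/\ symmetric t, subrel t e &
        unique_descent [set: T] t (fun _ _ => 1%N) D next].
Proof.
move=> [esym eirr] [/card_gt0P[r _] econ].
suff grow n : (0 < n <= #|T|)%N -> exists S : {set T}, #|S| = n /\
  exists t D next, [/\ symmetric t, subrel t e,
    forall i k, t i k -> (i \in S) && (k \in S) &
    unique_descent S t (fun _ _ => 1%N) D next].
  have [|S [cS [t [D [next [tsym te tS H]]]]]] := grow #|T|.
    by rewrite leqnn andbT; apply/card_gt0P; exists r.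
  have ST : S = [set: T].
    by apply/eqP; rewrite eqEcard finset.subsetT /= cardsT cS.
  by exists t, D, next; split=> //; rewrite -ST.
elim: n => // -[_ _|n IH /andP[_ nT]].
  exists [set r]; rewrite cards1; split=> //.
  exists (fun _ _ => false), (fun _ _ => 0%N), (fun i _ => i); split=> //.
  by split=> // i j; rewrite !inE => /eqP-> /eqP->; rewrite eqxx.
have [|S [cS [t [D [next [tsym te tS [D0 H]]]]]]] := IH.
  by rewrite (ltnW nT).
have [x xS] : exists x, x \in S by apply/card_gt0P; rewrite cS.
have [y yS] : exists y, y \notin S.
  apply/existsP; rewrite -negb_forall; apply/negP => /forallP allS.
  move: nT; rewrite -cS ltnNge => /negP; apply.
  by apply: subset_leq_card; apply/fintype.subsetP => z _; exact: allS.
have [q [p [qS pS eqp]]] := connect_exit (econ x y) xS yS.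
exists (p |: S); rewrite cardsU1 pS cS; split=> //.
exists (fun i k => [|| t i k, (i == p) && (k == q) | (i == q) && (k == p)]).
exists (fun i j => if i == p then if j == p then 0 else 1 + D q j
                   else if j == p then 1 + D i q else D i j)%N.
exists (fun i j => if i == p then q else
                   if j == p then if i == q then p else next i q else next i j).
have qp : (q == p) = false by apply/negP => /eqP qp; rewrite -qp qS in pS.
have tp i : t i p = false.
  by apply/negP => /tS/andP[_]; rewrite (negPf pS).
have tp' i : t p i = false by rewrite tsym tp.
have Sp i : i \in S -> (i == p) = false.
  by move=> iS; apply/negP => /eqP ip; rewrite -ip iS in pS.
split.
- by move=> i k; rewrite tsym orbC (andbC (i == p)) (andbC (i == q)) -orbA orbC -!orbA orbC;
    case: (t k i); case: (k == q); case: (i == p); case: (k == p); case: (i == q).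
- move=> i k /or3P[/te //|/andP[/eqP-> /eqP->]|/andP[/eqP-> /eqP->] //].
  by rewrite esym.
- move=> i k /or3P[/tS/andP[iS kS]|/andP[/eqP-> /eqP->]|/andP[/eqP-> /eqP->]];
    by rewrite !inE ?eqxx ?iS ?kS ?qS ?orbT.
split=> [j|i j]; first by case: (j == p).
rewrite !inE.
have [-> _|ip /= iS] := eqVneq i p.
  move=> /= jS pj; have jp : (j == p) = false by rewrite eq_sym (negPf pj).
  rewrite jp /= in jS *; rewrite qp !eqxx qS !orbT; split=> // k _.
  by rewrite tp' (eq_sym p q) qp /= orbF => /eqP->; rewrite eqxx.
have [-> _ _|jp /= jS ij] := eqVneq j p.
  rewrite eq_sym.
  have [<-|iq] := eqVneq q i.
    rewrite tp !eqxx !orbT D0; split=> // k _.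
    by move=> _ kp; rewrite (negPf kp).
  rewrite eq_sym in iq; have [tn nS Dn Hn] := H i q iS qS iq.
  rewrite (Sp _ nS) tn nS !orbT; split=> //; first by rewrite Dn.
  move=> k kS; rewrite orbF => tik kn.
  have kS' : k \in S by case/andP: (tS _ _ tik).
  by rewrite (Sp _ kS') ltn_add2l; exact: Hn.
have [tn nS Dn Hn] := H i j iS jS ij.
rewrite (Sp _ nS) tn nS orbT; split=> // k kS.
have [->|kp] := eqVneq k p.
  by rewrite tp /= andbT => /eqP->; rewrite add1n ltnS leqW.
rewrite /= andbF orbF => tik kn; apply: Hn => //; by case/andP: (tS _ _ tik).
Qed.

Lemma descent_weights (T : finType) (e : rel T) :
  simple_graph e -> connected_graph e ->
  exists a D next,
    [/\ forall i k, a i k = a k i, forall i k, (0 < a i k)%N &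
        unique_descent [set: T] e a D next].
Proof.
move=> sg cg; have [t [D [next [tsym te [D0 H]]]]] := spanning_tree_descent sg cg.
pose N := (\max_(u : T * T) D u.1 u.2).+1.
have DN i j : (D i j < N)%N.
  by rewrite ltnS (leq_bigmax (F := fun u : T * T => D u.1 u.2) (i, j)).
exists (fun i k => if t i k then 1 else N)%N, D, next; split.
- by move=> i k; rewrite tsym.
- by move=> i k; case: ifP.
split=> // i j iS jS ij; have [tn nS Dn Hn] := H i j iS jS ij.
rewrite tn te //; split=> // k kS _ kn; case: ifP => [tik|_]; first exact: Hn.
by apply: (leq_trans (DN i j)); rewrite leq_addr.
Qed.

Lemma geometric_limit (R : realType) (u : nat -> R) (C : R) :
  (forall n, `|u n.+1 - u n| <= C * (2^-1) ^+ n.+1) ->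
  exists g, forall n, `|u n - g| <= C * (2^-1) ^+ n.
Proof.
move=> Hu.
have C0 : 0 <= C by have := le_trans (normr_ge0 _) (Hu 0%N); rewrite expr1; lra.
pose w n := C * (2^-1) ^+ n.
have w0 n : 0 <= w n by rewrite mulr_ge0 ?exprn_ge0 ?invr_ge0.
have ws n : w n = 2 * w n.+1 by rewrite /w exprS; field.
have lo n m : u n - w n <= u (n + m)%N - w (n + m)%N.
  elim: m => [|m IH]; first by rewrite addn0.
  rewrite addnS; apply: le_trans IH _.
  by have := Hu (n + m)%N; rewrite ler_norml -/(w _) (ws (n + m)%N); lra.
have hi n m : u (n + m)%N + w (n + m)%N <= u n + w n.
  elim: m => [|m IH]; first by rewrite addn0.
  rewrite addnS; apply: le_trans IH.
  by have := Hu (n + m)%N; rewrite ler_norml -/(w _) (ws (n + m)%N); lra.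
have lohi n m : u n - w n <= u m + w m.
  have := lo n m; have := hi m n; rewrite addnC.
  by have := w0 (n + m)%N; lra.
pose A : set R := fun x => exists n, x = u n - w n.
have A0 : nonempty A by exists (u 0%N - w 0%N); exists 0%N.
have ubA n : ubound A (u n + w n) by move=> _ [m ->]; exact: lohi.
exists (sup A) => n; rewrite ler_norml -/(w n).
have h1 : u n - w n <= sup A.
  by apply: ub_le_sup; [exists (u 0%N + w 0%N); exact: ubA | exists n].
have h2 : sup A <= u n + w n by apply: ge_sup.
by apply/andP; split; lra.
Qed.

Lemma le_geometric (R : realType) (C x : R) :
  (forall n, x <= C * (2^-1) ^+ n) -> x <= 0.
Proof.
move=> Hx; rewrite leNgt; apply/negP => x0.
have C0 : 0 < C by have := Hx 0%N; rewrite expr0; lra.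
pose n := Num.Def.archi_bound (C / x).
have hn : C / x < n%:R by apply: archi_boundP; rewrite divr_ge0 // ltW.
have := Hx n; rewrite exprVn ler_pdivlMr ?exprn_gt0 // leNgt => /negP; apply.
rewrite mulrC -ltr_pdivrMr //; apply: (lt_le_trans hn).
by rewrite -natrX ler_nat ltnW // ltn_expl.
Qed.

Lemma box_fixed_point (R : realType) (I : finType) (r : I -> R)
    (F : (I -> R) -> I -> R) :
  (forall i, 0 <= r i) ->
  (forall f, (forall i, `|f i| <= r i) -> forall i, `|F f i| <= r i) ->
  (forall f g M, (forall i, `|f i| <= r i) -> (forall i, `|g i| <= r i) ->
     (forall i, `|f i - g i| <= M) -> forall i, `|F f i - F g i| <= M / 2) ->
  exists f, (forall i, `|f i| <= r i) /\ forall i, F f i = f i.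
Proof.
move=> r0 Fbox Flip.
pose u n := iter n F (fun _ => 0).
have ubox n i : `|u n i| <= r i.
  by elim: n i => [|n IH] i /=; [rewrite normr0 | exact: Fbox].
pose C := 2 * \sum_i r i.
have C0 : 0 <= C by rewrite mulr_ge0 // sumr_ge0.
have ustep n i : `|u n.+1 i - u n i| <= C * (2^-1) ^+ n.+1.
  elim: n i => [|n IH] i; last first.
    by rewrite exprSr mulrA; exact: (Flip (u n.+1) (u n) _ (ubox _) (ubox _) IH).
  rewrite expr1 /C mulrAC divff ?pnatr_eq0 // mul1r subr0.
  apply: le_trans (ubox 1%N i) _.
  by rewrite (bigD1 i) //= lerDl sumr_ge0.
have [f Hf] : {f : I -> R | forall i n, `|u n i - f i| <= C * (2^-1) ^+ n}.
  have P i := cid (geometric_limit (fun n => ustep n i)).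
  by exists (fun i => sval (P i)) => i; exact: (svalP (P i)).
have fbox i : `|f i| <= r i.
  rewrite -subr_le0; apply: (@le_geometric _ C) => n.
  have := ler_distD (u n i) (f i) 0; rewrite !subr0 distrC => h.
  by have := ubox n i; have := Hf i n; lra.
exists f; split=> // i; apply/eqP; rewrite -subr_eq0 -normr_le0.
apply: (@le_geometric _ C) => n.
have h1 : `|F f i - F (u n) i| <= C * 2^-1 ^+ n / 2.
  by apply: Flip => // k; rewrite distrC.
have h2 : `|F (u n) i - f i| <= C * 2^-1 ^+ n / 2.
  by have := Hf i n.+1; rewrite exprSr mulrA.
have := ler_distD (F (u n) i) (F f i) (f i); lra.
Qed.

(** * Nowhere zero eigenbases for prescribed simple spectra *)

Lemma finite_lower_bound (R : realType) (I : finType) (P : pred I) (f : I -> R) :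
  (forall i, P i -> 0 < f i) ->
  exists g, 0 < g /\ forall i, P i -> g <= f i.
Proof.
move=> f0; pose s := 1 + \sum_(i | P i) (f i)^-1.
have t0 : 0 <= \sum_(i | P i) (f i)^-1.
  by apply: sumr_ge0 => i Pi; rewrite invr_ge0 ltW ?f0.
have s0 : 0 < s by rewrite /s; lra.
exists s^-1; split=> [|i Pi]; first by rewrite invr_gt0.
rewrite -(invrK (f i)) lef_pV2 ?posrE ?invr_gt0 ?f0 // /s (bigD1 i) //=.
have : 0 <= \sum_(j | P j && (j != i)) (f j)^-1.
  by apply: sumr_ge0 => j /andP[Pj _]; rewrite invr_ge0 ltW ?f0.
lra.
Qed.

Lemma ler_sum_card (R : realType) (T : finType) (P : pred T) (f : T -> R) (c : R) :
  0 <= c -> (forall k, P k -> `|f k| <= c) ->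
  `|\sum_(k | P k) f k| <= #|T|%:R * c.
Proof.
move=> c0 fc; apply: le_trans (ler_norm_sum _ _ _) _.
apply: (@le_trans _ _ (\sum_(k | P k) c)); first exact: ler_sum.
by rewrite sumr_const mulr_natl ler_wpMn2l // max_card.
Qed.

(* [Z = 1 + X] where [X] is the fixed point of
   [X i j = ((W Z) i j - (W Z) i i * Z i j) / (lam j - lam i)]; the diagonal
   of [A = diag(lam + d) + W] is then forced by [A Z = Z diag(lam)] at [i = j].
   With [W i k = eps ^ a i k], [Z i j] is of exact order [eps ^ D i j]. *)
Lemma prescribed_spectrum_eigenbasis (R : realType) (T : finType) (e : rel T)
    (lam : T -> R) (tau : R) :
  simple_graph e -> connected_graph e -> injective lam -> 0 < tau ->
  exists A Z : T -> T -> R,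
    [/\ [/\ forall x y, A x y = A y x,
         forall x y, x != y -> (A x y != 0) = e x y &
         forall x j, \sum_y A x y * Z y j = Z x j * lam j],
      forall j, Z j j = 1, forall x j, Z x j != 0 &
      forall x j, x != j -> `|Z x j| <= tau].
Proof.
move=> sg cg lam_inj tau0.
have [a [D [next [asym a0 [D0 desc]]]]] := descent_weights sg cg.
have [esym eirr] := sg.
have gap0 (u : T * T) : u.1 != u.2 -> 0 < `|lam u.2 - lam u.1|.
  by move=> ij; rewrite normr_gt0 subr_eq0 (inj_eq lam_inj) eq_sym.
have [gam [gam0 Hgam]] := finite_lower_bound gap0.
have {}Hgam i j : i != j -> gam <= `|lam j - lam i| by apply: (Hgam (i, j)).
pose n : R := #|T|%:R.
have n1 : 1 <= n by rewrite /n ler1n; case: cg.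
pose Gam := 2 + \sum_(u : T * T) `|lam u.2 - lam u.1|.
have HGam i j : `|lam j - lam i| + 1 <= Gam.
  rewrite /Gam (bigD1 (i, j)) //=.
  have : 0 <= \sum_(u : T * T | u != (i, j)) `|lam u.2 - lam u.1| by exact: sumr_ge0.
  lra.
have Gam2 : 2 <= Gam by rewrite /Gam lerDl sumr_ge0.
pose rho := (2 * Gam)^-1.
have rho0 : 0 < rho by rewrite invr_gt0; lra.
have rho1 : rho <= 1 by rewrite invf_le1; lra.
pose N := \max_(u : T * T) D u.1 u.2.
have DN i j : (D i j <= N)%N.
  by rewrite (leq_bigmax (F := fun u : T * T => D u.1 u.2) (i, j)).
pose beta := n + 6 * n / gam.
have ng0 : 0 <= 6 * n / gam by apply: divr_ge0; lra.
have beta1 : 1 <= beta by rewrite /beta; lra.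
have beta0 : 0 < beta by exact: lt_le_trans beta1.
have n0 : 0 <= n by exact: ler0n.
have betan : n <= beta by rewrite /beta; lra.
have betag : 6 * n <= beta * gam.
  rewrite /beta [leRHS]mulrDl divfK ?gt_eqF // lerDr.
  by apply: mulr_ge0; lra.
pose c3 := rho ^+ N / (2 * n * beta ^+ N).
have bN0 : 0 < beta ^+ N by apply: exprn_gt0; lra.
have c30 : 0 < c3.
  by apply: divr_gt0; [exact: exprn_gt0 | apply: mulr_gt0 => //; lra].
have [eps [eps0 [epsb epst eps3]]] : exists eps : R, 0 < eps /\
    [/\ beta * eps <= 1, beta * eps <= tau & n * beta ^+ N * eps <= rho ^+ N / 2].
  exists (Num.min (Num.min 1 tau / beta) c3).
  rewrite lt_min c30 andbT divr_gt0 ?lt_min ?beta0 ?ltr01 ?tau0 //; split=> //.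
  have h1 : Num.min (Num.min 1 tau / beta) c3 <= Num.min 1 tau / beta.
    by rewrite ge_min lexx.
  have h2 : Num.min (Num.min 1 tau / beta) c3 <= c3.
    by rewrite ge_min lexx orbT.
  rewrite ler_pdivlMr // mulrC in h1.
  split.
  - by apply: le_trans h1 _; rewrite ge_min lexx.
  - by apply: le_trans h1 _; rewrite ge_min lexx orbT.
  - have q0 : 0 < n * beta ^+ N by rewrite mulr_gt0 //; lra.
    apply: le_trans (ler_wpM2l (ltW q0) h2) _.
    rewrite /c3 le_eqVlt; apply/orP; left; apply/eqP.
    field; rewrite !gt_eqF //; lra.
pose b := beta * eps.
have b0 : 0 < b by exact: mulr_gt0.
have epsE : eps = b / beta by rewrite /b mulrC mulKf // gt_eqF.
have eps_b : eps <= b by rewrite /b ler_peMl // ltW.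
have eps1 : eps <= 1 by exact: le_trans eps_b epsb.
pose W i k : R := if e i k then eps ^+ a i k else 0.
have Wsym i k : W i k = W k i by rewrite /W esym asym.
have Wii i : W i i = 0 by rewrite /W eirr.
have Weps i k : `|W i k| <= eps.
  rewrite /W; case: ifP => _; last by rewrite normr0 ltW.
  rewrite ger0_norm ?exprn_ge0 ?(ltW eps0) // -[leRHS]expr1.
  by apply: ler_wiXn2l => //; exact: ltW.
have Dtri i k j : e i k -> (D i j <= a i k + D k j)%N.
  move=> eik; have [->|ij] := eqVneq i j; first by rewrite D0.
  have [_ _ E Hn] := desc i j (finset.in_setT _) (finset.in_setT _) ij.
  have [->|kn] := eqVneq k (next i j); first by rewrite -E.
  by apply: ltnW; apply: Hn.
have Dpos i j : i != j -> (0 < D i j)%N.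
  move=> ij; have [_ _ -> _] := desc i j (finset.in_setT _) (finset.in_setT _) ij.
  by rewrite ltn_addr.
have Wterm i k j z : `|z| <= b ^+ D k j -> `|W i k * z| <= b ^+ D i j / beta.
  move=> zb; rewrite normrM /W; case: ifP => eik; last first.
    by rewrite normr0 mul0r divr_ge0 ?exprn_ge0 ?(ltW b0) ?(ltW beta0).
  rewrite (ger0_norm (exprn_ge0 _ (ltW eps0))).
  apply: (le_trans (ler_wpM2l (exprn_ge0 _ (ltW eps0)) zb)).
  have [lt|le] := ltnP (D k j) (D i j).
    have [m Em] : exists m, D i j = (m.+1 + D k j)%N.
      by exists (D i j - D k j).-1; rewrite prednK ?subn_gt0 // subnK // ltnW.
    have := Dtri i k j eik; rewrite Em leq_add2r => ma.
    rewrite exprD mulrAC ler_pM2r ?exprn_gt0 // exprSr -mulrA -epsE.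
    apply: (@le_trans _ _ (eps ^+ m.+1)).
      by apply: ler_wiXn2l => //; exact: ltW.
    rewrite exprSr ler_pM2r //.
    by apply: lerXn2r; rewrite ?nnegrE // ltW.
  apply: (@le_trans _ _ (eps * b ^+ D i j)).
    apply: ler_pM; rewrite ?exprn_ge0 ?(ltW eps0) ?(ltW b0) //.
      by rewrite -[leRHS]expr1; apply: ler_wiXn2l => //; exact: ltW.
    by apply: ler_wiXn2l => //; exact: ltW.
  rewrite mulrC ler_wpM2l ?exprn_ge0 ?(ltW b0) // epsE.
  by rewrite -[leRHS]mul1r ler_wpM2r // invr_ge0 ltW.
pose r (u : T * T) : R := if u.1 == u.2 then 0 else b ^+ D u.1 u.2.
pose Z (X : T * T -> R) i j : R := (i == j)%:R + X (i, j).
pose F (X : T * T -> R) (u : T * T) : R := if u.1 == u.2 then 0 else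
  (\sum_k W u.1 k * Z X k u.2 - (\sum_k W u.1 k * Z X k u.1) * Z X u.1 u.2)
  / (lam u.2 - lam u.1).
have r0 u : 0 <= r u by rewrite /r; case: ifP => // _; rewrite exprn_ge0 // ltW.
have Zb X : (forall u, `|X u| <= r u) -> forall i j, `|Z X i j| <= b ^+ D i j.
  move=> HX i j; have := HX (i, j); rewrite /r /Z /=.
  case: (eqVneq i j) => [->|_]; last by rewrite add0r.
  by rewrite normr_le0 => /eqP->; rewrite addr0 normr1 D0.
have Z1 X : (forall u, `|X u| <= r u) -> forall i j, `|Z X i j| <= 1.
  move=> HX i j; apply: le_trans (Zb X HX i j) _.
  by apply: exprn_ile1 => //; exact: ltW.
have dle X : (forall u, `|X u| <= r u) -> forall i,
    `|\sum_k W i k * Z X k i| <= n * eps.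
  move=> HX i; apply: ler_sum_card => [|k _]; first exact: ltW.
  by rewrite normrM -[leRHS]mulr1; apply: ler_pM => //; exact: Z1.
have divgam x y i j : i != j -> `|x| <= y * gam -> `|x / (lam j - lam i)| <= y.
  move=> ij xy; have lg := Hgam i j ij.
  have l0 : 0 < `|lam j - lam i| by exact: lt_le_trans lg.
  rewrite normrM normfV ler_pdivrMr //; apply: (le_trans xy).
  apply: ler_wpM2l lg.
  by rewrite -(pmulr_lge0 _ gam0); apply: le_trans xy.
have [||X [HX fixX]] := @box_fixed_point R _ r F r0.
- move=> X HX [i j]; rewrite /F /r /=.
  have [ij|ij] := eqVneq i j; first by rewrite normr0.
  apply: divgam => //.
  have h1 : `|\sum_k W i k * Z X k j| <= n * (b ^+ D i j / beta).
    apply: ler_sum_card => [|k _]; last by apply: Wterm; exact: Zb.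
    by rewrite divr_ge0 ?exprn_ge0 ?(ltW b0) ?(ltW beta0).
  have h2 : `|(\sum_k W i k * Z X k i) * Z X i j| <= n * eps * b ^+ D i j.
    by rewrite normrM; apply: ler_pM => //; [exact: dle | exact: Zb].
  apply: le_trans (ler_normB _ _) _.
  have B0 : 0 <= b ^+ D i j by rewrite exprn_ge0 // ltW.
  have e1 : eps <= beta^-1 by rewrite -[leRHS]mul1r ler_pdivlMr // mulrC.
  have h3 : n * eps * b ^+ D i j <= n * beta^-1 * b ^+ D i j.
    by apply: ler_wpM2r => //; apply: ler_wpM2l.
  have h4 : 2 * n * beta^-1 <= gam.
    by rewrite ler_pdivrMr // mulrC; clear - betag n0; lra.
  have h5 : 2 * n * beta^-1 * b ^+ D i j <= gam * b ^+ D i j by exact: ler_wpM2r.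
  by clear - h1 h2 h3 h5; lra.
- move=> X Y M HX HY XY [i j]; rewrite /F /=.
  have M0 : 0 <= M by apply: le_trans (XY (i, j)).
  have [ij|ij] := eqVneq i j; first by rewrite subr0 normr0 divr_ge0.
  rewrite -mulrBl; apply: divgam => //.
  have ZM k l : `|Z X k l - Z Y k l| <= M by rewrite /Z opprD addrACA subrr add0r.
  have SM l : `|\sum_k W i k * Z X k l - \sum_k W i k * Z Y k l| <= n * (eps * M).
    rewrite -sumrB; apply: ler_sum_card => [|k _]; first by rewrite mulr_ge0 // ltW.
    by rewrite -mulrBr normrM; apply: ler_pM.
  set P := \sum_k W i k * Z X k j; set Q := \sum_k W i k * Z X k i.
  set P' := \sum_k W i k * Z Y k j; set Q' := \sum_k W i k * Z Y k i.
  have -> : P - Q * Z X i j - (P' - Q' * Z Y i j) =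
    (P - P') - (Q - Q') * Z X i j - Q' * (Z X i j - Z Y i j) by ring.
  have h1 := SM j; have h2 := SM i.
  have h3 : `|(Q - Q') * Z X i j| <= n * (eps * M).
    by rewrite normrM -[leRHS]mulr1; apply: ler_pM => //; exact: Z1.
  have h4 : `|Q' * (Z X i j - Z Y i j)| <= n * eps * M.
    by rewrite normrM; apply: ler_pM => //; exact: dle.
  have h5 : 6 * n * (eps * M) <= gam * M.
    have : beta * gam * (eps * M) <= gam * M.
      have -> : beta * gam * (eps * M) = (beta * eps) * (gam * M) by ring.
      by rewrite ler_piMl // mulr_ge0 // ltW.
    apply: le_trans; apply: ler_wpM2r => //.
    by rewrite mulr_ge0 // ltW.
  apply: le_trans (ler_normB _ _) _.
  have := ler_normB (P - P') ((Q - Q') * Z X i j).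
  rewrite -/P -/P' -/Q -/Q' in h1 h2.
  by clear - h1 h2 h3 h4 h5; lra.
have {}fixX i j : i != j -> (lam j - lam i) * Z X i j =
    \sum_k W i k * Z X k j - (\sum_k W i k * Z X k i) * Z X i j.
  move=> ij; have := fixX (i, j); rewrite /F /= (negPf ij) => E.
  rewrite {1}/Z (negPf ij) add0r -E mulrC divfK // subr_eq0.
  by rewrite (inj_eq lam_inj) eq_sym.
have Zjj j : Z X j j = 1.
  have := HX (j, j); rewrite /Z /r /= !eqxx normr_le0 => /eqP->.
  by rewrite addr0.
pose d i := - \sum_k W i k * Z X k i.
pose A i k : R := (i == k)%:R * (lam i + d i) + W i k.
have AZ i j : \sum_k A i k * Z X k j = (lam i + d i) * Z X i j + \sum_k W i k * Z X k j.
  rewrite -[X in _ = X + _](_ : \sum_k (i == k)%:R * (lam i + d i) * Z X k j = _).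
    by rewrite -big_split /=; apply: eq_bigr => k _; rewrite -mulrDl.
  rewrite (bigD1 i) //= eqxx mul1r big1 ?addr0 // => k.
  by rewrite eq_sym => /negPf->; rewrite !mul0r.
exists A, (Z X); split=> //.
- split=> [x y|x y xy|x j].
  + rewrite /A Wsym; case: (eqVneq x y) => [->//|xy].
    by rewrite !mul0r.
  + rewrite /A (negPf xy) mul0r add0r /W; case: ifP => _; last by rewrite eqxx.
    by rewrite expf_eq0 gt_eqF // andbF.
  + rewrite AZ; have [->|xj] := eqVneq x j.
      by rewrite Zjj mulr1 /d addrNK mul1r.
    by have := fixX x j xj; rewrite /d => E; clear - E; lra.
- suff low m i j : (D i j <= m)%N -> (rho * eps) ^+ D i j <= `|Z X i j|.
    move=> x j; rewrite -normr_gt0; apply: lt_le_trans (low _ _ _ (leqnn _)).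
    by rewrite exprn_gt0 // mulr_gt0.
  elim: m i j => [|m IH] i j Dm; have [->|ij] := eqVneq i j;
    rewrite ?D0 ?Zjj ?expr0 ?normr1 //.
    by have := Dpos i j ij; rewrite ltnNge Dm.
  have [ein _ E Hn] := desc i j (finset.in_setT _) (finset.in_setT _) ij.
  have ap := a0 i (next i j).
  set p := next i j in ein E Hn ap *.
  have Dpm : (D p j <= m)%N.
    by rewrite -ltnS; apply: leq_trans Dm; rewrite E -add1n leq_add2r.
  have IHp := IH p j Dpm.
  have HW : (lam j - lam i - d i) * Z X i j =
      W i p * Z X p j + \sum_(k | k != p) W i k * Z X k j.
    have S : \sum_k W i k * Z X k j =
        W i p * Z X p j + \sum_(k | k != p) W i k * Z X k j.
      by rewrite (bigD1 p).
    have E' := fixX i j ij; rewrite S in E'; rewrite /d.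
    by clear - E'; lra.
  have rest : `|\sum_(k | k != p) W i k * Z X k j| <=
      n * (beta ^+ N * eps * eps ^+ D i j).
    apply: ler_sum_card => [|k kp].
      by rewrite !mulr_ge0 ?exprn_ge0 ?(ltW eps0) ?(ltW beta0).
    rewrite normrM /W; case: ifP => eik; last first.
      by rewrite normr0 mul0r !mulr_ge0 ?exprn_ge0 ?(ltW eps0) ?(ltW beta0).
    rewrite (ger0_norm (exprn_ge0 _ (ltW eps0))).
    apply: le_trans (ler_wpM2l (exprn_ge0 _ (ltW eps0)) (Zb X HX k j)) _.
    rewrite /b exprMn mulrCA -exprD -mulrA -exprS.
    have hk := Hn k (finset.in_setT _) eik kp.
    apply: ler_pM; rewrite ?exprn_ge0 ?(ltW eps0) ?(ltW beta0) //.
      by apply: ler_weXn2l.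
    by apply: ler_wiXn2l => //; exact: ltW.
  have kap : `|lam j - lam i - d i| <= Gam.
    apply: le_trans (HGam i j); apply: le_trans (ler_normB _ _) _.
    rewrite lerD2l /d normrN; apply: le_trans (dle X HX i) _.
    by apply: le_trans epsb; apply: ler_wpM2r => //; exact: ltW.
  have main : eps ^+ D i j * rho ^+ D p j <= `|W i p * Z X p j|.
    rewrite normrM {1}/W ein (ger0_norm (exprn_ge0 _ (ltW eps0))) E exprD.
    rewrite -mulrA ler_wpM2l ?exprn_ge0 ?(ltW eps0) //.
    by rewrite -exprMn mulrC.
  have rN : rho ^+ N <= rho ^+ D p j by apply: ler_wiXn2l => //; exact: ltW.
  have eD0 : 0 <= eps ^+ D i j by rewrite exprn_ge0 // ltW.
  have small : n * (beta ^+ N * eps * eps ^+ D i j) <=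
      eps ^+ D i j * rho ^+ D p j / 2.
    have -> : n * (beta ^+ N * eps * eps ^+ D i j) =
      eps ^+ D i j * (n * beta ^+ N * eps) by ring.
    by rewrite -[leRHS]mulrA; apply: ler_wpM2l => //; clear - eps3 rN; lra.
  have half : eps ^+ D i j * rho ^+ D p j / 2 <= Gam * `|Z X i j|.
    apply: (@le_trans _ _ `|(lam j - lam i - d i) * Z X i j|).
      rewrite HW; have := lerB_normD (W i p * Z X p j) (\sum_(k | k != p) W i k * Z X k j).
      by clear - main rest small; lra.
    by rewrite normrM ler_wpM2r.
  have rhoD : rho ^+ D i j <= rho * rho ^+ D p j.
    rewrite -exprS E; apply: ler_wiXn2l => //; first exact: ltW.
    by rewrite -add1n leq_add2r.
  rewrite exprMn mulrC; apply: le_trans (ler_wpM2l eD0 rhoD) _.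
  rewrite mulrCA /rho mulrC ler_pdivrMr; last by clear - Gam2; lra.
  by rewrite -/rho; clear - half; lra.
- move=> x j xj; apply: le_trans (Zb X HX x j) _.
  apply: le_trans epst; rewrite -/b -[leRHS]expr1.
  by apply: ler_wiXn2l; [exact: ltW | | exact: Dpos].
Qed.

Definition orthonormal_columns (R : realType) (T L : finType) (N : T -> L -> R) : Prop :=
  forall l m, \sum_x N x l * N x m = (l == m)%:R.

Lemma sum_delta (R : realType) (L : finType) (l : L) (f : L -> R) :
  \sum_m (l == m)%:R * f m = f l.
Proof.
rewrite (bigD1 l) //= eqxx mul1r big1 ?addr0 // => m.
by rewrite eq_sym => /negPf->; rewrite mul0r.
Qed.

Lemma orthonormal_parseval (R : realType) (T L : finType) (N : T -> L -> R) (a b : L -> R) :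
  orthonormal_columns N ->
  \sum_x (\sum_l N x l * a l) * (\sum_m N x m * b m) = \sum_l a l * b l.
Proof.
move=> oN.
transitivity (\sum_l \sum_m a l * b m * (\sum_x N x l * N x m)).
  under eq_bigr => x _ do rewrite mulr_suml.
  rewrite exchange_big /=; apply: eq_bigr => l _.
  under eq_bigr => x _ do rewrite mulr_sumr.
  rewrite exchange_big /=; apply: eq_bigr => m _.
  by rewrite mulr_sumr; apply: eq_bigr => x _; ring.
apply: eq_bigr => l _; under eq_bigr => m _ do rewrite oN mulrC.
exact: (sum_delta l (fun m => a l * b m)).
Qed.

Lemma sum_enum_val (R : realType) (T : finType) (F : T -> R) :
  \sum_(i < #|T|) F (enum_val i) = \sum_x F x.
Proof. by rewrite [RHS](reindex _ (onW_bij _ (@enum_val_bij T))). Qed.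

Lemma orthonormal_rows (R : realType) (T : finType) (U : T -> T -> R) :
  orthonormal_columns U -> orthonormal_columns (fun x y => U y x).
Proof.
move=> oU.
pose M : 'M[R]_#|T| := \matrix_(i, j) U (enum_val i) (enum_val j).
have M1 : M^T *m M = 1%:M.
  apply/matrixP => i j; rewrite !mxE -(inj_eq enum_val_inj) -oU -[RHS]sum_enum_val.
  by apply: eq_bigr => k _; rewrite !mxE.
move=> x y; have /matrixP/(_ (enum_rank x) (enum_rank y)) := mulmx1C M1.
rewrite !mxE (inj_eq enum_rank_inj) => <-; rewrite -[LHS]sum_enum_val.
by apply: eq_bigr => k _; rewrite !mxE !enum_rankK.
Qed.

Lemma prescribed_spectrum_orthonormal (R : realType) (T : finType) (e : rel T)
    (lam : T -> R) (tau : R) :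
  simple_graph e -> connected_graph e -> injective lam -> 0 < tau ->
  exists A U : T -> T -> R,
    [/\ [/\ forall x y, A x y = A y x,
         forall x y, x != y -> (A x y != 0) = e x y &
         forall x j, \sum_y A x y * U y j = U x j * lam j],
      orthonormal_columns U, forall x j, U x j != 0,
      forall x j, x != j -> `|U x j| <= tau & forall j, 2^-1 <= U j j <= 1].
Proof.
move=> sg cg lam_inj tau0.
pose n : R := #|T|%:R.
have n1 : 1 <= n by rewrite /n ler1n; case: cg.
pose tau' := Num.min tau n^-1.
have n0 : 0 < n by exact: lt_le_trans n1.
have tau'0 : 0 < tau' by rewrite lt_min tau0 invr_gt0.
have [A [Z [[Asym Apat AZ] Zjj Z0 Zt]]] :=
  prescribed_spectrum_eigenbasis sg cg lam_inj tau'0.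
pose q j := \sum_x Z x j ^+ 2.
have q1 j : 1 <= q j.
  rewrite /q (bigD1 j) //= Zjj expr1n lerDl sumr_ge0 // => x _; exact: sqr_ge0.
have q2 j : q j <= 2.
  rewrite /q (bigD1 j) //= Zjj expr1n.
  suff : \sum_(x | x != j) Z x j ^+ 2 <= 1 by lra.
  apply: le_trans (ler_norm _) _; rewrite -(mulfV (lt0r_neq0 n0)).
  apply: ler_sum_card => [|x xj]; first by rewrite invr_ge0 ltW.
  have zt := Zt x j xj; rewrite normrX expr2 -[leRHS]mulr1.
  have zn : `|Z x j| <= n^-1 by apply: le_trans zt _; rewrite ge_min lexx orbT.
  apply: ler_pM => //; apply: le_trans zn _; rewrite invf_le1 //.
have q0 j : 0 < q j by exact: lt_le_trans (q1 j).
pose s j := (Num.sqrt (q j))^-1.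
have sq0 j : 0 < Num.sqrt (q j) by rewrite sqrtr_gt0.
have s0 j : 0 < s j by rewrite invr_gt0.
have ss j : s j ^+ 2 = (q j)^-1 by rewrite /s exprVn sqr_sqrtr // ltW.
have s1 j : s j <= 1.
  by rewrite -(@expr_le1 _ 2) // ?ss ?invf_le1 // ltW.
have shalf j : 2^-1 <= s j.
  apply: (@le_trans _ _ (s j ^+ 2)); last by rewrite expr2 ler_piMl // ltW.
  by rewrite ss lef_pV2 ?posrE.
have AU x j : \sum_y A x y * (Z y j * s j) = Z x j * s j * lam j.
  under eq_bigr => y _ do rewrite mulrA.
  by rewrite -mulr_suml AZ mulrAC.
exists A, (fun x j => Z x j * s j); split.
- by split.
- move=> i j /=; have [<-|ij] := eqVneq i j.
    rewrite (eq_bigr (fun x => Z x i ^+ 2 * s i ^+ 2)); last by move=> x _; ring.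
    by rewrite -mulr_suml -/(q i) ss mulfV // gt_eqF.
  set G := (X in X = _).
  suff : lam i * G = lam j * G.
    move=> E; apply/eqP; have : (lam i - lam j) * G == 0 by rewrite mulrBl E subrr.
    by rewrite mulf_eq0 subr_eq0 (inj_eq lam_inj) (negPf ij).
  transitivity (\sum_x \sum_y A x y * (Z y i * s i) * (Z x j * s j)).
    by rewrite mulr_sumr; apply: eq_bigr => x _; rewrite -mulr_suml AU; ring.
  rewrite exchange_big mulr_sumr; apply: eq_bigr => y _ /=.
  transitivity ((Z y i * s i) * \sum_x A y x * (Z x j * s j)).
    by rewrite mulr_sumr; apply: eq_bigr => x _; rewrite (Asym x y); ring.
  by rewrite AU; ring.
- by move=> x j; rewrite mulf_neq0 // gt_eqF.
- move=> x j xj; rewrite normrM (gtr0_norm (s0 j)) -[leRHS]mulr1.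
  apply: ler_pM => //; first exact: ltW.
  by apply: le_trans (Zt x j xj) _; rewrite ge_min lexx.
- by move=> j; rewrite Zjj mul1r shalf s1.
Qed.

(* [A] acts as [diag mu] on the span of the orthonormal columns of [N], and
   as a symmetric involution on its orthogonal complement. *)
Definition involution_off (R : realType) (T L : finType) (e : rel T) (mu : L -> R)
    (A : T -> T -> R) (N : T -> L -> R) : Prop :=
  [/\ forall x y, A x y = A y x,
      forall x y, x != y -> (A x y != 0) = e x y,
      orthonormal_columns N,
      forall x l, \sum_y A x y * N y l = N x l * mu l &
      forall x z, \sum_y A x y * A y z + \sum_l N x l * (1 - mu l ^+ 2) * N z l
                  = (x == z)%:R].

Lemma involution_off_of_spectrum (R : realType) (T L : finType) (e : rel T)
    (lam : T -> R) (mu : L -> R) (f : L -> T) (A U : T -> T -> R) :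
  (forall x y, A x y = A y x) ->
  (forall x y, x != y -> (A x y != 0) = e x y) ->
  (forall x j, \sum_y A x y * U y j = U x j * lam j) ->
  orthonormal_columns U -> injective f ->
  (forall l, lam (f l) = mu l) ->
  (forall t, t \notin codom f -> lam t ^+ 2 = 1) ->
  involution_off e mu A (fun x l => U x (f l)).
Proof.
move=> Asym Apat AU oU finj lamf lam1; have oUr := orthonormal_rows oU.
have AE y z : A y z = \sum_t U z t * (U y t * lam t).
  transitivity (\sum_w A y w * \sum_t U w t * U z t).
    rewrite (eq_bigr (fun w => (z == w)%:R * A y w)) ?sum_delta // => w _.
    by rewrite (oUr w z) eq_sym mulrC.
  under eq_bigr => w _ do rewrite mulr_sumr.
  rewrite exchange_big /=; apply: eq_bigr => t _.
  rewrite -AU mulr_sumr; apply: eq_bigr => w _; ring.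
split=> // [l m|x l|x z]; first by rewrite oU (inj_eq finj).
  by rewrite AU lamf.
have -> : \sum_y A x y * A y z = \sum_t U x t * lam t ^+ 2 * U z t.
  under eq_bigr => y _ do rewrite (AE y z) mulr_sumr.
  rewrite exchange_big /=; apply: eq_bigr => t _.
  transitivity (U z t * lam t * \sum_y A x y * U y t).
    by rewrite mulr_sumr; apply: eq_bigr => y _; ring.
  by rewrite AU; ring.
have -> : \sum_l U x (f l) * (1 - mu l ^+ 2) * U z (f l) =
          \sum_t U x t * (1 - lam t ^+ 2) * U z t.
  rewrite [RHS](bigID (fun t => t \in codom f)) /= [X in _ = _ + X]big1 ?addr0.
    rewrite -big_uniq /=; last by apply/injectiveP.
    by rewrite big_image; apply: eq_bigr => l _; rewrite lamf.
  by move=> t tf; rewrite lam1 // subrr mulr0 mul0r.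
rewrite -big_split /= -oUr; apply: eq_bigr => t _; ring.
Qed.

(** * Orthogonal symmetric matrices with the pattern of a join *)

Lemma num_eig_involution (R : realType) (n : nat) (Q : 'M[R]_n) :
  Q *m Q = 1%:M -> Q != 1%:M -> Q != - 1%:M -> num_eig Q 2.
Proof.
move=> QQ Q1 QN1; exists [:: 1; -1]; split=> //.
  by rewrite /= inE andbT; apply/eqP; lra.
have eig (c : R) (M : 'M[R]_n) : M != 0 -> M *m Q = c *: M -> eigenvalue Q c.
  move=> /rowV0Pn[v /submxP[w ->] v0] E; apply/eigenvalueP.
  by exists (w *m M) => //; rewrite -mulmxA E -scalemxAr.
move=> a; rewrite !inE; apply/idP/orP => [/eigenvalueP[v vQ v0]|[/eqP->|/eqP->]].
- have : (a ^+ 2 - 1) *: v = 0.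
    by rewrite scalerBl scale1r expr2 -scalerA -vQ scalemxAl -vQ -mulmxA QQ mulmx1 subrr.
  move/eqP; rewrite scaler_eq0 (negPf v0) orbF subr_eq0 sqrf_eq1.
  by case/orP => ->; [left | right].
- apply: (eig _ (Q + 1%:M)); first by rewrite addr_eq0.
  by rewrite mulmxDl QQ mul1mx addrC scale1r.
- apply: (eig _ (Q - 1%:M)); first by rewrite subr_eq0.
  by rewrite mulmxBl QQ mul1mx scaleN1r opprB.
Qed.

Definition diag_family (R : realType) (I : finType) (S T : I -> finType)
    (F : forall i, S i -> T i -> R)
    (u : {i : I & S i}) (v : {i : I & T i}) : R :=
  untag 0 (F (tag u) (tagged u)) v.

Lemma diag_family_same (R : realType) (I : finType) (S T : I -> finType)
    (F : forall i, S i -> T i -> R) i x y :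
  diag_family F (Tagged S (i := i) x) (Tagged T y) = F i x y.
Proof. exact: (untagE 0 (F i x) (u := Tagged T y) (erefl i)). Qed.

Lemma diag_family_diff (R : realType) (I : finType) (S T : I -> finType)
    (F : forall i, S i -> T i -> R) u v :
  tag u != tag v -> diag_family F u v = 0.
Proof. by move=> uv; rewrite /diag_family untag_dflt // eq_sym. Qed.

Lemma sum_sigma (R : realType) (I : finType) (T : I -> finType) (f : {i : I & T i} -> R) :
  \sum_u f u = \sum_i \sum_(x : T i) f (Tagged T x).
Proof.
rewrite (sig_big_dep (fun=> true) (fun _ _ => true) (fun i x => f (Tagged T x))) /=.
by apply: eq_bigr => -[].
Qed.

Lemma sum_diag_family (R : realType) (I : finType) (S T : I -> finType)
    (F : forall i, S i -> T i -> R) i x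
    (g : {i : I & T i} -> R) :
  \sum_v diag_family F (Tagged S (i := i) x) v * g v =
  \sum_(y : T i) F i x y * g (Tagged T y).
Proof.
rewrite sum_sigma (bigD1 i) //= [X in _ + X]big1 ?addr0.
  by apply: eq_bigr => y _; rewrite diag_family_same.
move=> j ji; apply: big1 => y _; rewrite diag_family_diff ?mul0r //=.
by rewrite eq_sym.
Qed.

Lemma sum_diag_family_l (R : realType) (I : finType) (S T : I -> finType)
    (F : forall i, S i -> T i -> R) i y
    (g : {i : I & S i} -> R) :
  \sum_u diag_family F u (Tagged T (i := i) y) * g u =
  \sum_(x : S i) F i x y * g (Tagged S x).
Proof.
rewrite sum_sigma (bigD1 i) //= [X in _ + X]big1 ?addr0.
  by apply: eq_bigr => x _; rewrite diag_family_same.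
by move=> j ji; apply: big1 => x _; rewrite diag_family_diff ?mul0r.
Qed.

Lemma sigma_eqE (I : finType) (T : I -> finType) (i : I) (x y : T i) :
  (Tagged T x == Tagged T y) = (x == y).
Proof. by rewrite -tag_eqE /tag_eq /= eqxx tagged_asE. Qed.

Lemma involution_off_gunion (R : realType) (I : finType) (T L : I -> finType)
    (e : forall i, rel (T i))
    (mu : forall i, L i -> R) (A : forall i, T i -> T i -> R)
    (N : forall i, T i -> L i -> R) :
  (forall i, involution_off (e i) (mu i) (A i) (N i)) ->
  involution_off (gunion e) (fun u : {i : I & L i} => mu (tag u) (tagged u))
    (diag_family A) (diag_family N).
Proof.
move=> H; split.
- move=> [i x] [j y]; have [E|ij] := eqVneq i j; last first.
    by rewrite !diag_family_diff //= eq_sym.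
  by case: j / E in y *; rewrite !diag_family_same; case: (H i).
- move=> [i x] [j y]; rewrite /gunion /=; have [E|ij] := eqVneq i j; last first.
    by rewrite diag_family_diff //= eqxx.
  case: j / E in y *; rewrite sigma_eqE diag_family_same tagged_asE => xy.
  by case: (H i) => _ P _ _ _; rewrite P.
- move=> [i l] [j m].
  rewrite (sum_diag_family_l N l (fun u => diag_family N u (Tagged L m))).
  have [E|ij] := eqVneq i j; last first.
    rewrite -tag_eqE /tag_eq /= (negPf ij) big1 // => x _.
    by rewrite diag_family_diff ?mulr0.
  case: j / E in m *; rewrite sigma_eqE; case: (H i) => _ _ <- _ _.
  by apply: eq_bigr => x _; rewrite diag_family_same.
- move=> [i x] [j l]; rewrite (sum_diag_family A x (fun u => diag_family N u (Tagged L l))).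
  have [E|ij] := eqVneq i j; last first.
    rewrite [RHS]mulrC diag_family_diff ?mulr0 // big1 // => y _.
    by rewrite diag_family_diff ?mulr0.
  case: j / E in l *; rewrite diag_family_same /=; case: (H i) => _ _ _ <- _.
  by apply: eq_bigr => y _; rewrite diag_family_same.
- move=> [i x] [j z]; rewrite (sum_diag_family A x (fun u => diag_family A u (Tagged T z))).
  under [X in _ + X]eq_bigr => v _ do rewrite -mulrA.
  rewrite (sum_diag_family N x (fun u => (1 - mu (tag u) (tagged u) ^+ 2) *
     diag_family N (Tagged T z) u)).
  have [E|ij] := eqVneq i j; last first.
    rewrite -tag_eqE /tag_eq /= (negPf ij) !big1 ?addr0 // => y _.
      by rewrite [X in _ * (_ * X)]diag_family_diff ?mulr0 //= eq_sym.
    by rewrite diag_family_diff ?mulr0.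
  case: j / E in z *; rewrite sigma_eqE; case: (H i) => _ _ _ _ <-.
  congr (_ + _); apply: eq_bigr => y _; rewrite diag_family_same //.
  by rewrite mulrA.
Qed.

Lemma involution_off_rotate (R : realType) (T L : finType) (e : rel T) (mu : L -> R)
    (A : T -> T -> R) (N : T -> L -> R) (O : L -> L -> R) :
  involution_off e mu A N -> orthonormal_columns O ->
  (forall l m, mu l != mu m -> O l m = 0) ->
  involution_off e mu A (fun x l => \sum_m N x m * O l m).
Proof.
move=> [Asym Apat oN AN AA] oO Omu; have oOr := orthonormal_rows oO.
have comm l m (f : R -> R) : O l m * f (mu l) = O l m * f (mu m).
  by have [->//|/Omu->] := eqVneq (mu l) (mu m); rewrite !mul0r.
split=> //.
- by move=> l m; rewrite orthonormal_parseval // oOr.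
- move=> x l; under eq_bigr => y _ do rewrite mulr_sumr.
  rewrite exchange_big mulr_suml; apply: eq_bigr => m _ /=.
  rewrite -mulrA (comm l m id) /= mulrCA mulrC -AN mulr_suml.
  by apply: eq_bigr => y _; ring.
- move=> x z; rewrite -AA; congr (_ + _).
  transitivity (\sum_l (\sum_m O l m * (N x m * (1 - mu m ^+ 2))) *
                       (\sum_m O l m * N z m)).
    apply: eq_bigr => l _; congr (_ * _); last by apply: eq_bigr => m _; rewrite mulrC.
    rewrite mulr_suml; apply: eq_bigr => m _.
    by rewrite -mulrA (comm l m (fun t => 1 - t ^+ 2)); ring.
  exact: orthonormal_parseval.
Qed.

Lemma involution_off_join (R : realType) (U W L : finType) (eU : rel U) (eW : rel W)
    (mu : L -> R) (A : U -> U -> R) (N : U -> L -> R) (C : W -> W -> R) (M : W -> L -> R) :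
  (0 < #|U|)%N -> (0 < #|W|)%N -> (forall l, mu l ^+ 2 <= 1) ->
  involution_off eU mu A N -> involution_off eW mu C M ->
  (forall x y, \sum_l N x l * (Num.sqrt (1 - mu l ^+ 2) * M y l) != 0) ->
  exists Q, inS (R := R) (gjoin eU eW) Q /\ num_eig Q 2.
Proof.
move=> /card_gt0P[x0 _] /card_gt0P[y0 _] mu1 [As Ap oN AN AA] [Cs Cp oM CM CC] B0.
pose s l := Num.sqrt (1 - mu l ^+ 2).
have ss l : s l * s l = 1 - mu l ^+ 2 by rewrite -expr2 sqr_sqrtr // subr_ge0.
pose B x y := \sum_l N x l * (s l * M y l).
have AB x y : \sum_z A x z * B z y = \sum_l N x l * mu l * (s l * M y l).
  under eq_bigr => z _ do rewrite mulr_sumr.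
  rewrite exchange_big; apply: eq_bigr => l _ /=.
  by rewrite -AN mulr_suml; apply: eq_bigr => z _; ring.
have BC x y : \sum_z C y z * B x z = \sum_l N x l * mu l * (s l * M y l).
  under eq_bigr => z _ do rewrite mulr_sumr.
  rewrite exchange_big; apply: eq_bigr => l _ /=.
  transitivity (N x l * s l * (M y l * mu l)); last by ring.
  by rewrite -CM mulr_sumr; apply: eq_bigr => z _; ring.
have BB x z : \sum_y B x y * B z y = \sum_l N x l * (1 - mu l ^+ 2) * N z l.
  transitivity (\sum_y (\sum_l M y l * (N x l * s l)) * (\sum_l M y l * (N z l * s l))).
    by apply: eq_bigr => y _; congr (_ * _); apply: eq_bigr => l _; ring.
  by rewrite orthonormal_parseval //; apply: eq_bigr => l _; rewrite -ss; ring.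
have BB' y z : \sum_x B x y * B x z = \sum_l M y l * (1 - mu l ^+ 2) * M z l.
  transitivity (\sum_x (\sum_l N x l * (M y l * s l)) * (\sum_l N x l * (M z l * s l))).
    by apply: eq_bigr => x _; congr (_ * _); apply: eq_bigr => l _; ring.
  by rewrite orthonormal_parseval //; apply: eq_bigr => l _; rewrite -ss; ring.
pose q (u v : U + W) : R := match u, v with
  | inl x, inl z => A x z | inl x, inr y => B x y
  | inr y, inl x => B x y | inr y, inr z => - C y z end.
pose Q : 'M[R]_#|{: U + W}| := \matrix_(i, j) q (enum_val i) (enum_val j).
have Qr u v : Q (enum_rank u) (enum_rank v) = q u v by rewrite mxE !enum_rankK.
exists Q; split; first split.
- apply/matrixP => i j; rewrite !mxE.
  have qs u v : q v u = q u v.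
    by case: u v => [x|y] [z|w]; rewrite /q ?(As z x) ?(Cs w y).
  exact: qs.
- move=> u v; rewrite Qr; case: u v => [x|y] [z|w] /= uv.
  + by apply: Ap; apply: contra uv => /eqP->.
  + by rewrite B0.
  + by rewrite B0.
  + by rewrite oppr_eq0; apply: Cp; apply: contra uv => /eqP->.
have qq u v : \sum_w q u w * q w v = (u == v)%:R.
  rewrite big_sumType /=; case: u v => [x|y] [z|w] /=.
  - by rewrite BB AA.
  - rewrite AB; under [X in _ + X]eq_bigr => y _ do rewrite mulrN (Cs y w) mulrC.
    by rewrite sumrN BC subrr.
  - under eq_bigr => x _ do rewrite (As x z) mulrC.
    by rewrite AB; under eq_bigr => v _ do rewrite mulNr; rewrite sumrN BC subrr.
  - rewrite BB' addrC; under eq_bigr => v _ do rewrite mulrNN.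
    by rewrite CC.
have Qoff : Q (enum_rank (inl x0)) (enum_rank (inr y0)) != 0 by rewrite Qr B0.
apply: num_eig_involution.
- apply/matrixP => i j; rewrite !mxE -(inj_eq enum_val_inj) -qq -[RHS]sum_enum_val.
  by apply: eq_bigr => k _; rewrite !mxE.
- by apply: contra Qoff => /eqP->; rewrite mxE (inj_eq enum_rank_inj).
- by apply: contra Qoff => /eqP->; rewrite !mxE (inj_eq enum_rank_inj) oppr0.
Qed.

(** * Linking two connected graphs *)

Lemma symmetric_single_eigenvalue (R : realType) (n : nat) (A : 'M[R]_n) :
  A^T = A -> (forall a b, eigenvalue A a -> eigenvalue A b -> a = b) ->
  forall i j, i != j -> A i j = 0.
Proof.
move=> Asym A1 i j ij.
pose f := real_complex R; pose M := map_mx f A.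
have Mherm : M \is hermsymmx.
  apply/is_hermitianmxP; rewrite expr0 scale1r; apply/matrixP => k l.
  by rewrite !mxE /= -[in LHS]Asym mxE; symmetry; exact: conjc_real.
have Mspec := orthomx_spectralP (hermitian_normalmx Mherm).
have Preal := hermitian_spectral_diag_real Mherm.
set P := spectralmx M in Mspec; set d := spectral_diag M in Mspec Preal.
have Pu : P \in unitmx by exact: spectral_unit.
have deig k : exists2 r, d 0 k = f r & eigenvalue A r.
  have /complex_realP[r dr] : d 0 k \is Num.real by exact: (mxOverP Preal).
  exists r => //; have : eigenvalue M (f r).
    apply/eigenvalueP; exists (row k P).
      rewrite -row_mul {1}Mspec !mulmxA mulmxV // mul1mx (_ : f r = d 0 k) //.
      by apply/rowP => l; rewrite mul_diag_mx !mxE.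
    by apply/negP => /eqP /(congr1 (mulmx^~ (invmx P))); rewrite -row_mul mulmxV //
      mul0mx => /rowP/(_ k); rewrite !mxE eqxx => /eqP; rewrite oner_eq0.
  by rewrite !eigenvalue_root_char -map_char_poly fmorph_root.
have dconst k : d 0 k = d 0 i.
  by have [r -> ra] := deig k; have [s -> sa] := deig i; rewrite (A1 r s).
have : M i j = 0.
  have -> : M = (d 0 i)%:M.
    rewrite Mspec; have -> : diag_mx d = (d 0 i)%:M.
      by apply/matrixP => k l; rewrite !mxE dconst.
    by rewrite mul_mx_scalar -scalemxAl mulVmx // scalemx1.
  by rewrite mxE (negPf ij).
by rewrite mxE => /eqP; rewrite fmorph_eq0 => /eqP.
Qed.

Lemma q_lower_bound (R : realType) (T : finType) (e : rel T) (x y : T) :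
  x != y -> e x y -> forall (A : 'M[R]_#|T|) n, inS e A -> num_eig A n -> (2 <= n)%N.
Proof.
move=> xy exy A n [Asym Apat] [s [us <- sP]]; rewrite leqNgt; apply/negP => s2.
have := Apat x y xy; rewrite exy => /negP; apply; apply/eqP.
apply: symmetric_single_eigenvalue => //; last by rewrite (inj_eq enum_rank_inj).
move=> a b; rewrite !sP; case: s s2 {us sP} => [|c [|//]] _ //.
by rewrite !inE => /eqP-> /eqP->.
Qed.

Definition grid (R : realType) (a : nat) (l : 'I_a.+1) : R := l%:R / a.+1%:R.

Lemma grid0 (R : realType) (a : nat) : grid R (ord0 : 'I_a.+1) = 0.
Proof. by rewrite /grid mul0r. Qed.

Lemma grid_sq_lt1 (R : realType) (a : nat) (l : 'I_a.+1) : grid R l ^+ 2 < 1.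
Proof.
by rewrite expr_lt1 // /grid ?divr_ge0 ?ler0n // ltr_pdivrMr ?ltr0n // mul1r ltr_nat.
Qed.

Lemma sqrt_grid_gt0 (R : realType) (a : nat) (l : 'I_a.+1) :
  0 < Num.sqrt (1 - grid R l ^+ 2).
Proof. by rewrite sqrtr_gt0 subr_gt0 grid_sq_lt1. Qed.

Lemma sqrt_grid_le1 (R : realType) (a : nat) (l : 'I_a.+1) :
  Num.sqrt (1 - grid R l ^+ 2) <= 1.
Proof. by rewrite -[leRHS]sqrtr1 ler_sqrt ?gerBl ?sqr_ge0 //. Qed.

(* The at most two vertices beyond the [a.+1] grid points get eigenvalues [1] and [-1]. *)
Lemma connected_involution_off (R : realType) (T : finType) (e : rel T) (a : nat) (tau : R) :
  simple_graph e -> connected_graph e -> (a < #|T| <= a + 3)%N -> 0 < tau ->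
  exists A N (f : 'I_a.+1 -> T),
    [/\ involution_off e (@grid R a) A N, injective f, forall x l, N x l != 0,
        forall x l, x != f l -> `|N x l| <= tau & forall l, 2^-1 <= N (f l) l].
Proof.
move=> sg cg /andP[aT Ta] tau0.
pose lam (t : T) : R :=
  if (enum_rank t <= a.+1)%N then (enum_rank t)%:R / a.+1%:R else -1.
have a0 : 0 < a.+1%:R :> R by rewrite ltr0n.
have lam_inj : injective lam.
  move=> t u; rewrite /lam.
  have big (v : T) : (enum_rank v <= a.+1)%N = false -> nat_of_ord (enum_rank v) = a.+2.
    move=> /negbT; rewrite -ltnNge => h; apply/eqP; rewrite eqn_leq h andbT.
    by rewrite -ltnS; apply: leq_trans (ltn_ord _) _; rewrite -addn3.
  have pos (v : T) : 0 <= (enum_rank v)%:R / a.+1%:R :> R.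
    by rewrite divr_ge0 ?ler0n.
  case: ifP => ht; case: ifP => hu h.
  - apply: enum_rank_inj; apply: val_inj => /=; apply/eqP.
    by rewrite -(eqr_nat R); apply/eqP; apply: (mulIf _ h); rewrite invr_eq0 gt_eqF.
  - by have := pos t; rewrite h => ?; exfalso; lra.
  - by have := pos u; rewrite -h => ?; exfalso; lra.
  - by apply: enum_rank_inj; apply: val_inj; rewrite /= (big _ ht) (big _ hu).
have [A [U [[As Ap AU] oU U0 Ut Uj]]] := prescribed_spectrum_orthonormal sg cg lam_inj tau0.
pose f (l : 'I_a.+1) := enum_val (widen_ord aT l).
have f_inj : injective f.
  by move=> l m /enum_val_inj /(congr1 val) /= h; apply: val_inj.
exists A, (fun x l => U x (f l)), f; split=> //; last first.
- by move=> l; case/andP: (Uj (f l)).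
- by move=> x l; exact: Ut.
apply: involution_off_of_spectrum As Ap AU oU f_inj _ _ => [l|t tf].
  by rewrite /lam /f enum_valK /= ltnW.
rewrite /lam; case: ifP => [h|_]; last by rewrite sqrrN expr1n.
have -> : nat_of_ord (enum_rank t) = a.+1.
  apply/eqP; rewrite eqn_leq h /= ltnNge; apply: contra tf => h'.
  apply/codomP; exists (Ordinal (h' : (enum_rank t < a.+1)%N)).
  by rewrite /f -[LHS]enum_rankK; congr enum_val; exact: val_inj.
by rewrite divff ?gt_eqF // expr1n.
Qed.

(* In [lb_mix], [t] stands for a diagonal entry of the orthogonal matrix that
   mixes the shared eigenvalue [0] over the components. *)
Record linked_blocks (R : realType) (T1 T2 : finType) (e1 : rel T1) (e2 : rel T2) : Type :=
  LinkedBlocks {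
    lb_size : nat;
    lb_A : T1 -> T1 -> R;
    lb_N : T1 -> 'I_lb_size.+1 -> R;
    lb_C : T2 -> T2 -> R;
    lb_M : T2 -> 'I_lb_size.+1 -> R;
    lb_AN : involution_off e1 (@grid R lb_size) lb_A lb_N;
    lb_CM : involution_off e2 (@grid R lb_size) lb_C lb_M;
    lb_N0 : forall x, lb_N x ord0 != 0;
    lb_M0 : forall y, lb_M y ord0 != 0;
    lb_mix : forall t x y, 2^-1 <= t <= 1 ->
      t * (lb_N x ord0 * lb_M y ord0) +
      \sum_(l | l != ord0) lb_N x l * (Num.sqrt (1 - grid R l ^+ 2) * lb_M y l) != 0 }.

Lemma linked_blocks_sym (R : realType) (T1 T2 : finType) (e1 : rel T1) (e2 : rel T2) :
  linked_blocks R e1 e2 -> linked_blocks R e2 e1.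
Proof.
case=> a A N C M AN CM N0 M0 mix; apply: (LinkedBlocks CM AN M0 N0) => t y x t1.
have := mix t x y t1; rewrite (mulrC (N x ord0)).
rewrite (eq_bigr (fun l => M y l * (Num.sqrt (1 - grid R l ^+ 2) * N x l))) // => l _.
ring.
Qed.

Lemma linked_blocks_of_involution_off (R : realType) (T1 T2 : finType) (e1 : rel T1)
    (e2 : rel T2) (a : nat) (A : T1 -> T1 -> R) (N : T1 -> 'I_a.+1 -> R) :
  involution_off e1 (@grid R a) A N -> (forall x l, N x l != 0) ->
  simple_graph e2 -> connected_graph e2 -> #|T2| = a.+1 ->
  inhabited (linked_blocks R e1 e2).
Proof.
move=> AN N0 sg cg card2.
have pos (u : T1 * 'I_a.+1) : xpredT u ->
    0 < Num.sqrt (1 - grid R u.2 ^+ 2) * `|N u.1 u.2|.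
  by move=> _; rewrite mulr_gt0 ?sqrt_grid_gt0 ?normr_gt0.
have [g [g0 Hg]] := finite_lower_bound pos.
have N1 x l : `|N x l| <= 1.
  have [_ _ oN _ _] := AN.
  rewrite -(@expr_le1 _ 2) // -normrX ger0_norm ?sqr_ge0 //.
  suff : N x l ^+ 2 <= \sum_y N y l * N y l by rewrite oN eqxx.
  rewrite (bigD1 x) //=.
  by rewrite expr2 lerDl sumr_ge0 // => y _; rewrite -expr2 sqr_ge0.
pose n : R := #|'I_a.+1|%:R.
have n0 : 0 < n by rewrite ltr0n card_ord.
pose tau := g / (8 * n).
have tau0 : 0 < tau by rewrite divr_gt0 // mulr_gt0.
have [|C [M [f [CM finj M0 Mt Mf]]]] :=
  @connected_involution_off R T2 e2 a tau sg cg _ tau0.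
  by rewrite card2 leqnn addn3 -addn3 /= -addn1 leq_add2l.
have fbij : bijective f by apply: inj_card_bij => //; rewrite card2 card_ord.
apply: (inhabits (LinkedBlocks AN CM _ _ _)) => // t x y /andP[t1 t2].
pose w (l : 'I_a.+1) : R := if l == ord0 then t else Num.sqrt (1 - grid R l ^+ 2).
have w0 l : 0 <= w l.
  rewrite /w; case: ifP => _; last exact: ltW (sqrt_grid_gt0 _ _).
  by apply: le_trans t1; rewrite invr_ge0.
have w1 l : w l <= 1.
  by rewrite /w; case: ifP => // _; exact: sqrt_grid_le1.
have wN l : g / 2 <= w l * `|N x l|.
  have := Hg (x, l) isT; rewrite /w /=; case: eqP => [->|_]; last by lra.
  rewrite grid0 expr0n subr0 sqrtr1 mul1r => h.
  have := normr_ge0 (N x ord0); nra.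
have -> : t * (N x ord0 * M y ord0) +
    \sum_(l | l != ord0) N x l * (Num.sqrt (1 - grid R l ^+ 2) * M y l) =
    \sum_l w l * N x l * M y l.
  rewrite [RHS](bigD1 ord0) //= {1}/w eqxx mulrA; congr (_ + _).
  by apply: eq_bigr => l /negPf l0; rewrite /w l0; ring.
have [f' ff' f'f] := fbij; have -> : y = f (f' y) by rewrite f'f.
set l := f' y; rewrite (bigD1 l) //=.
have rest : `|\sum_(m | m != l) w m * N x m * M (f l) m| <= n * tau.
  apply: ler_sum_card => [|m ml]; first exact: ltW.
  rewrite !normrM -[leRHS]mul1r; apply: ler_pM => //.
  - by rewrite mulr_ge0.
  - by rewrite -[leRHS]mulr1; apply: ler_pM => //; rewrite ger0_norm.
  - by apply: Mt; rewrite (inj_eq finj) eq_sym.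
have ntau : n * tau = g / 8.
  by rewrite /tau; field; rewrite gt_eqF.
have main : g / 4 <= `|w l * N x l * M (f l) l|.
  rewrite !normrM (ger0_norm (w0 l)).
  have -> : g / 4 = (g / 2) * 2^-1 by field.
  apply: ler_pM (wN l) (le_trans (Mf l) (ler_norm _)).
    by rewrite divr_ge0 // ltW.
  by rewrite invr_ge0.
rewrite -normr_gt0; apply: lt_le_trans (lerB_normD _ _); lra.
Qed.

Lemma connected_linked_blocks (R : realType) (T1 T2 : finType) (e1 : rel T1) (e2 : rel T2) :
  simple_graph e1 -> simple_graph e2 -> connected_graph e1 -> connected_graph e2 ->
  (#|T1| <= #|T2| + 2)%N -> (#|T2| <= #|T1| + 2)%N ->
  inhabited (linked_blocks R e1 e2).
Proof.
have larger (S1 S2 : finType) (f1 : rel S1) (f2 : rel S2) :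
    simple_graph f1 -> simple_graph f2 -> connected_graph f1 -> connected_graph f2 ->
    (#|S2| <= #|S1| <= #|S2| + 2)%N -> inhabited (linked_blocks R f1 f2).
  move=> s1 s2 c1 c2; case E : #|S2| => [|a]; first by case: c2; rewrite E.
  rewrite addSn -addnS => /connected_involution_off H.
  have [A [N [f [AN _ N0 _ _]]]] := H R f1 1 s1 c1 ltr01.
  exact: linked_blocks_of_involution_off AN N0 s2 c2 E.
move=> s1 s2 c1 c2 h12 h21; have [le|/ltnW le] := leqP #|T2| #|T1|.
  by apply: larger => //; rewrite le.
have [|B] := larger T2 T1 e2 e1 s2 s1 c2 c1; first by rewrite le.
exact: inhabits (linked_blocks_sym B).
Qed.

Lemma complete_simple (m : nat) : simple_graph (@complete m).
Proof. by split=> [x y|x]; rewrite /complete ?eqxx // eq_sym. Qed.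

Lemma complete_connected (m : nat) : (0 < m)%N -> connected_graph (@complete m).
Proof.
move=> m0; split=> [|x y]; first by rewrite card_ord.
by have [->//|xy] := eqVneq x y; apply: connect1.
Qed.

(* Distribute each row of a basis for [K_(a+1)] over a fibre of [g] with
   weights of unit square sum, and take [A = 1 - N (1 - mu) N^T]. *)
Lemma complete_involution_off (R : realType) (m a : nat) : (a < m)%N ->
  exists A N, involution_off (@complete m) (@grid R a) A N /\ forall x l, N x l != 0.
Proof.
move=> am.
have ar : (a < #|'I_a.+1| <= a + 3)%N by rewrite card_ord leqnn -addn1 leq_add2l.
have [A0 [N0 [_ [[A0s A0p oN0 AN0 AA0] _ N00 _ _]]]] :=
  @connected_involution_off R 'I_a.+1 _ a 1 (complete_simple _)
    (complete_connected (ltn0Sn a)) ar ltr01.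
have oN0r := orthonormal_rows oN0.
have mu0 (l : 'I_a.+1) : 0 < 1 - grid R l.
  rewrite subr_gt0 -(@expr_lt1 _ 2) ?grid_sq_lt1 //.
  by rewrite /grid divr_ge0 ?ler0n.
have P0 z z' : \sum_l N0 z l * (1 - grid R l) * N0 z' l != 0.
  have [<-|zz'] := eqVneq z z'.
    rewrite gt_eqF // (bigD1 ord0) //=; apply: ltr_wpDr.
      apply: sumr_ge0 => l _; rewrite mulrAC -expr2.
      by rewrite mulr_ge0 ?sqr_ge0 ?ltW.
    by rewrite mulrAC -expr2 mulr_gt0 // exprn_even_gt0 //= N00.
  have A0E : A0 z z' = \sum_l N0 z l * grid R l * N0 z' l.
    transitivity (\sum_w A0 z w * \sum_l N0 w l * N0 z' l).
      rewrite (eq_bigr (fun w => (z' == w)%:R * A0 z w)) ?sum_delta // => w _.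
      by rewrite (oN0r w z') eq_sym mulrC.
    under eq_bigr => w _ do rewrite mulr_sumr.
    rewrite exchange_big /=; apply: eq_bigr => l _.
    by rewrite -AN0 mulr_suml; apply: eq_bigr => w _; ring.
  have -> : \sum_l N0 z l * (1 - grid R l) * N0 z' l = - A0 z z'.
    have := oN0r z z'; rewrite (negPf zz') A0E => E.
    rewrite -[RHS]add0r -[X in X - _]E -sumrB; apply: eq_bigr => l _; ring.
  by rewrite oppr_eq0 A0p.
pose g (x : 'I_m) : 'I_a.+1 := inord (minn x a).
pose c z : R := #|[pred x | g x == z]|%:R.
have c0 z : 0 < c z.
  rewrite ltr0n; apply/card_gt0P; exists (widen_ord am z); rewrite inE.
  apply/eqP/val_inj; rewrite /= inordK ?ltnS ?geq_minr //.
  by apply/minn_idPl; exact: (leq_ord z).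
pose p x := (Num.sqrt (c (g x)))^-1.
have p0 x : p x != 0 by rewrite invr_eq0 gt_eqF // sqrtr_gt0.
have pp x : p x * p x = (c (g x))^-1.
  by rewrite -expr2 exprVn sqr_sqrtr // ltW.
pose N x l := p x * N0 (g x) l.
pose A x y := (x == y)%:R - \sum_l N x l * ((1 - grid R l) * N y l).
have oN : orthonormal_columns N.
  move=> l k; rewrite -oN0 (partition_big g xpredT) //=; apply: eq_bigr => z _.
  rewrite (eq_bigr (fun=> (c z)^-1 * (N0 z l * N0 z k))); last first.
    by move=> x /eqP <-; rewrite -pp /N; ring.
  rewrite sumr_const -mulr_natl mulrA -[X in X / _]/(c z).
  by rewrite divff ?mul1r // gt_eqF.
have AN x l : \sum_y A x y * N y l = N x l * grid R l.
  under eq_bigr => y _ do rewrite mulrBl.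
  rewrite sumrB sum_delta.
  suff -> : \sum_y (\sum_k N x k * ((1 - grid R k) * N y k)) * N y l =
            N x l * (1 - grid R l) by ring.
  under eq_bigr => y _ do rewrite mulr_suml.
  rewrite exchange_big /= (bigD1 l) //= [X in _ + X]big1 ?addr0.
    transitivity (N x l * (1 - grid R l) * \sum_y N y l * N y l).
      by rewrite mulr_sumr; apply: eq_bigr => y _; ring.
    by rewrite oN eqxx mulr1.
  move=> k kl; transitivity (N x k * (1 - grid R k) * \sum_y N y k * N y l).
    by rewrite mulr_sumr; apply: eq_bigr => y _; ring.
  by rewrite oN (negPf kl) mulr0.
exists A, N; split; last by move=> x l; rewrite mulf_neq0.
split=> //.
- move=> x y; rewrite /A eq_sym; congr (_ - _); apply: eq_bigr => l _; ring.
- move=> x y xy; rewrite /complete xy /A (negPf xy) sub0r oppr_eq0.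
  have -> : \sum_l N x l * ((1 - grid R l) * N y l) =
    p x * p y * \sum_l N0 (g x) l * (1 - grid R l) * N0 (g y) l.
    by rewrite mulr_sumr; apply: eq_bigr => l _; rewrite /N; ring.
  by rewrite !mulf_neq0.
- move=> x z.
  have -> : \sum_y A x y * A y z =
      A x z - \sum_l N x l * grid R l * (1 - grid R l) * N z l.
    transitivity (\sum_y ((z == y)%:R * A x y -
        \sum_l A x y * N y l * ((1 - grid R l) * N z l))).
      apply: eq_bigr => y _; rewrite {2}/A mulrBr mulr_sumr eq_sym mulrC.
      by congr (_ - _); apply: eq_bigr => l _; rewrite mulrA.
    rewrite sumrB sum_delta; congr (_ - _).
    rewrite exchange_big; apply: eq_bigr => l _ /=.
    by rewrite -mulr_suml AN mulrA.
  rewrite /A -addrA -addrA -[RHS]addr0; congr (_ + _).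
  rewrite -!sumrN -!big_split /= big1 // => l _; ring.
Qed.

Lemma linked_blocks_join (R : realType) (k : nat) (VG VH : 'I_k -> finType)
    (eG : forall i, rel (VG i)) (eH : forall i, rel (VH i)) :
  (0 < k)%N -> (forall i, 0 < #|VG i|)%N -> (forall i, 0 < #|VH i|)%N ->
  (forall i, inhabited (linked_blocks R (eG i) (eH i))) ->
  q_eq R (gjoin (gunion eG) (gunion eH)) 2.
Proof.
move=> k0 G0 H0 B'; pose B i := inhabited_witness (B' i).
have tagged_gt0 (V : 'I_k -> finType) : (forall i, 0 < #|V i|)%N ->
    (0 < #|{: {i : 'I_k & V i}}|)%N.
  move=> V0; have /card_gt0P[x _] := V0 (Ordinal k0).
  by apply/card_gt0P; exists (Tagged V x).
have Gt := tagged_gt0 _ G0; have Ht := tagged_gt0 _ H0.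
split; last first.
  have /card_gt0P[x _] := Gt; have /card_gt0P[y _] := Ht.
  by move=> A n; apply: (@q_lower_bound R _ _ (inl x) (inr y)).
have i_inj : injective (fun i : 'I_k => (nat_of_ord i)%:R : R).
  by move=> i j /eqP; rewrite eqr_nat => /eqP; apply: val_inj.
have [_ [O [_ oO O0 _ Oi]]] := prescribed_spectrum_orthonormal
  (complete_simple k) (complete_connected k0) i_inj ltr01.
pose L i : finType := 'I_(lb_size (B i)).+1.
pose mu (u : {i : 'I_k & L i}) : R := grid R (tagged u).
pose z0 i : L i := ord0.
pose O' (u v : {i : 'I_k & L i}) : R :=
  if (tagged u == z0 (tag u)) && (tagged v == z0 (tag v)) then O (tag u) (tag v)
  else (u == v)%:R.
have O'mu u v : mu u != mu v -> O' u v = 0.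
  rewrite /O'; case: ifP => [/andP[/eqP u0 /eqP v0]|_].
    by rewrite /mu u0 v0 !grid0 eqxx.
  by have [->|//] := eqVneq u v; rewrite eqxx.
have neq0 i j (l : L j) : l != z0 j -> (Tagged L (z0 i) == Tagged L l) = false.
  move=> l0; apply/eqP => E.
  have : (fun w : {i : 'I_k & L i} => tagged w == z0 (tag w)) (Tagged L l) by rewrite -E /=.
  by rewrite /= (negPf l0).
have oO' : orthonormal_columns O'.
  have nz (u v : {i : 'I_k & L i}) : tagged v != z0 (tag v) -> O' u v = (v == u)%:R.
    by move=> v0; rewrite /O' (negPf v0) andbF eq_sym.
  have nz' (u v : {i : 'I_k & L i}) : tagged u != z0 (tag u) -> O' u v = (u == v)%:R.
    by move=> u0; rewrite /O' (negPf u0).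
  move=> u v; have [u0|u0] := eqVneq (tagged u) (z0 (tag u)); last first.
    under eq_bigr => w _ do rewrite (nz w u u0).
    by rewrite sum_delta nz'.
  have [v0|v0] := eqVneq (tagged v) (z0 (tag v)); last first.
    under eq_bigr => w _ do rewrite (nz w v v0) mulrC.
    by rewrite sum_delta nz' // eq_sym.
  rewrite sum_sigma; case: u v u0 v0 => [i l] [j m] /= -> ->.
  transitivity (\sum_q O q i * O q j).
    apply: eq_bigr => q _; rewrite (bigD1 (z0 q)) //= /O' /= !eqxx /=.
    rewrite big1 ?addr0 // => r rq; rewrite (negPf rq) /=.
    by rewrite eq_sym neq0 // mul0r.
  rewrite oO; congr (_%:R); rewrite -tag_eqE /tag_eq /=.
  by case: eqVneq => // E; case: j / E m; rewrite tagged_asE eqxx.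
have AN := involution_off_gunion (fun i => lb_AN (B i)).
have CM := involution_off_gunion (fun i => lb_CM (B i)).
apply: (involution_off_join Gt Ht _ AN (involution_off_rotate CM oO' O'mu)) => [u|].
  exact: ltW (grid_sq_lt1 _ _).
move=> [i x] [j y].
rewrite (sum_diag_family (fun i => lb_N (l := B i)) x
  (fun u => Num.sqrt (1 - mu u ^+ 2) *
     \sum_v diag_family (fun i => lb_M (l := B i)) (Tagged VH y) v * O' u v)).
under eq_bigr => l _ do rewrite (sum_diag_family (fun i => lb_M (l := B i)) y (O' (Tagged L l))).
rewrite (bigD1 (z0 i)) //=.
have mu00 : Num.sqrt (1 - mu (Tagged L (z0 i)) ^+ 2) = 1.
  by rewrite /mu /= grid0 expr0n subr0 sqrtr1.
have row0 : \sum_m lb_M (l := B j) y m * O' (Tagged L (z0 i)) (Tagged L m) =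
    lb_M (l := B j) y ord0 * O i j.
  rewrite (bigD1 (z0 j)) //= big1 ?addr0 => [|m m0]; first by rewrite /O'.
  by rewrite /O' /= (negPf m0) neq0 // mulr0.
rewrite row0 mu00 mul1r.
have [E|ij] := eqVneq i j.
  case: j / E in y row0 *.
  have /andP[o1 o2] := Oi i.
  have := @lb_mix _ _ _ _ _ (B i) (O i i) x y (Oi i); rewrite [O i i * _]mulrC mulrA.
  congr (is_true (_ + _ != 0)).
  apply: eq_bigr => l l0; congr (_ * (_ * _)).
  rewrite (eq_bigr (fun m => (l == m)%:R * lb_M (l := B i) y m)) ?sum_delta // => m _.
  by rewrite /O' /= (negPf l0) /= sigma_eqE mulrC.
rewrite [X in _ + X]big1 ?addr0 ?mulf_neq0 ?lb_N0 ?lb_M0 // => l l0.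
rewrite [X in _ * (_ * X)]big1 ?mulr0 // => m _.
by rewrite /O' /= (negPf l0) /= -tag_eqE /tag_eq /= (negPf ij) mulr0.
Qed.

Theorem theorem3p4 (R : realType) :
  (forall (k : nat) (VG VH : 'I_k -> finType)
          (eG : forall i, rel (VG i)) (eH : forall i, rel (VH i)),
      (0 < k)%N ->
      (forall i, simple_graph (eG i)) -> (forall i, simple_graph (eH i)) ->
      (forall i, connected_graph (eG i)) -> (forall i, connected_graph (eH i)) ->
      (forall i, #|VG i| <= #|VH i| + 2 /\ #|VH i| <= #|VG i| + 2)%N ->
      q_eq R (gjoin (gunion eG) (gunion eH)) 2)
  /\
  (forall (k : nat) (m : 'I_k -> nat) (VH : 'I_k -> finType)
          (eH : forall i, rel (VH i)),
      (0 < k)%N -> (forall i, 0 < m i)%N ->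
      (forall i, simple_graph (eH i)) -> (forall i, connected_graph (eH i)) ->
      (forall i, #|VH i| <= m i + 2)%N ->
      q_eq R (gjoin (gunion (fun i => @complete (m i))) (gunion eH)) 2).
Proof.
split=> [k VG VH eG eH k0 sG sH cG cH card|k m VH eH k0 m0 sH cH card].
  apply: linked_blocks_join => // i; [by case: (cG i) | by case: (cH i) |].
  by have [h1 h2] := card i; apply: connected_linked_blocks.
apply: linked_blocks_join => // i; [by rewrite card_ord | by case: (cH i) |].
have [le|lt] := leqP #|VH i| (m i); last first.
  apply: connected_linked_blocks => //; rewrite ?card_ord //.
  - exact: complete_simple.
  - exact: complete_connected.
  - by apply: ltnW; apply: leq_trans lt _; rewrite leq_addr.
case E : #|VH i| le => [|a] le; first by case: (cH i); rewrite E.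
have [A [N [AN N0]]] := complete_involution_off R le.
exact: linked_blocks_of_involution_off AN N0 (sH i) (cH i) E.
Qed.
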